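(* Let $\mathfrak{L}_{\mathbb{Q}}$ be the $\mathbb{Q}$-algebra generated by the special values of multiple polylogarithms at rational points. Then for every $r\geq 1$, $$\zeta^{\mathcal{C}}(\underbrace{1,\ldots,1}_{r},2)\in\mathfrak{L}_{\mathbb{Q}}.$$
   Context: For $d\geq 1$ and integers $k_1,\ldots,k_d\geq 1$, the multiple polylogarithm is $$\mathrm{Li}_{k_1,\ldots,k_d}(z_1,\ldots,z_d)=\sum_{0<n_1<\cdots<n_d}\frac{z_1^{n_1}\cdots z_d^{n_d}}{n_1^{k_1}\cdots n_d^{k_d}}.$$ For $k_d=1$ it converges for $|z_1|,\ldots,|z_d|<1$, and for $k_d\geq 2$ it converges for $|z_1|,\ldots,|z_d|\leq 1$. A special value at a rational point is a number $\mathrm{Li}_{k_1,\ldots,k_d}(z_1,\ldots,z_d)$ with all $z_i\in\mathbb{Q}$ at which the series converges; $\mathfrak{L}_{\mathbb{Q}}$ is the $\mathbb{Q}$-subalgebra of $\mathbb{R}$ generated by all such numbers (all $d\geq 1$, all indices). For integers $k_1,\ldots,k_{m-1}\geq 1$, $k_m\geq 2$, the continuous multiple zeta value is $$\zeta^{\mathcal{C}}(k_1,\ldots,k_m)=\int\cdots\int_{[1,+\infty)^m}\frac{dx_1\cdots dx_m}{x_1^{k_1}(x_1+x_2)^{k_2}\cdots(x_1+\cdots+x_m)^{k_m}}.$$ In $\zeta^{\mathcal{C}}(\underbrace{1,\ldots,1}_{r},2)$ there are $r$ entries equal to $1$ followed by one entry $2$, so $m=r+1$. *)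

(* Defs.v *)
From mathcomp Require Import all_boot all_order all_algebra.
From mathcomp Require Import all_classical all_reals all_analysis.

Set Implicit Arguments.
Unset Strict Implicit.
Unset Printing Implicit Defensive.

Import Order.TTheory GRing.Theory Num.Theory numFieldNormedType.Exports.

Local Open Scope classical_set_scope.
Local Open Scope ring_scope.

(* Partial sums over 0 < n_1 < ... < n_d < N; the d-fold series is the limit
   of these as N tends to infinity. *)
Definition polylog_partial (R : realType) (d : nat) (k : d.-tuple nat)
    (z : d.-tuple R) (N : nat) : R :=
  \sum_(n : d.-tuple 'I_N | path ltn 0%N [seq val i | i <- n])
    \prod_(i < d) (tnth z i ^+ tnth n i / (tnth n i)%:R ^+ tnth k i).

Definition polylog_converges (R : realType) (d : nat) (k : d.-tuple nat)
    (z : d.-tuple R) : Prop := cvgn (polylog_partial k z).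

Definition polylog (R : realType) (d : nat) (k : d.-tuple nat)
    (z : d.-tuple R) : R := limn (polylog_partial k z).

Definition polylog_rational_values (R : realType) : set R :=
  [set v | exists (d : nat) (k : d.-tuple nat) (q : d.-tuple rat),
     let z : d.-tuple R := [tuple of [seq ratr a | a <- q]] in
     [/\ (0 < d)%N, (forall i, (0 < tnth k i)%N),
         polylog_converges k z & v = polylog k z]].

(* [GRing.subalg_closed] for the action of rat on R through [ratr]; R has no
   canonical [lalgType rat] structure. *)
Definition Q_subalgebra (R : realType) (A : set R) : Prop :=
  [/\ A 1,
      (forall (a : rat) (x y : R), A x -> A y -> A (ratr a * x + y)) &
      (forall x y : R, A x -> A y -> A (x * y))].

Definition polylog_algebra (R : realType) : set R :=
  smallest (@Q_subalgebra R) (@polylog_rational_values R).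

(* The integral over [1, +oo[^m as an m-fold iterated Lebesgue integral,
   valued in \bar R. For nonnegative measurable integrands, as below, this is
   the integral for the product measure by Tonelli's theorem. *)
Fixpoint integral_ge1 (R : realType) (m : nat) :
    (m.-tuple R -> \bar R) -> \bar R :=
  match m with
  | 0 => fun f => f [tuple]
  | m'.+1 => fun f =>
      (\int[@lebesgue_measure R]_(x in `[1%R, +oo[)
         integral_ge1 (fun y : m'.-tuple R => f [tuple of x :: y]))%E
  end.

(* Keeping the value in \bar R makes the finiteness of the integral part of
   any claim that it equals a real number. *)
Definition continuous_mzv (R : realType) (m : nat) (k : m.-tuple nat) : \bar R :=
  integral_ge1 (fun x : m.-tuple R =>
    ((\prod_(i < m) (\sum_(j < m | (j <= i)%N) tnth x j) ^+ tnth k i)^-1)%:E).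

(* Main.v *)
Require Import Defs.
From mathcomp Require Import all_boot all_order all_algebra.
From mathcomp Require Import all_classical all_reals all_analysis.
From mathcomp Require Import measurable_realfun ring lra.

Set Implicit Arguments.
Unset Strict Implicit.
Unset Printing Implicit Defensive.

Import Order.TTheory GRing.Theory Num.Theory numFieldNormedType.Exports.

Local Open Scope classical_set_scope.
Local Open Scope ring_scope.

(* With [G_0(s) = 1/s] and [G_(K+1)(s) = int_(x >= 1) G_K(s + x) / (s + x) dx],
   the integral is [G_(r+1)(0)]. In the variable [w = 1/(s + K)] the function
   [G_K] is a power series with nonnegative coefficients: since
   [dx / x = - (1/w + K / (1 - K w)) dw] when [w = 1/(x + K)], integrating
   termwise shows that the coefficients of [G_(K+1)] are
   [n |-> 1/n * sum_(m <= n) c_m K^(n - m)], where [c] are those of [G_K].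
   The term [m = n] of this sum raises the last exponent of a multiple
   polylogarithm by one and the terms [m < n] append a new argument [1/K] with
   exponent 1, so that [G_(r+1)(0)] is a finite sum of multiple polylogarithms
   at nonnegative rational points. As all terms are nonnegative, each of them
   converges because their sum does. *)

(** * Truncated multiple polylogarithms as nested sums *)

Lemma sum_tuple_cons (V : nmodType) (d : nat) (T : finType)
    (P : pred (d.+1.-tuple T)) (F : d.+1.-tuple T -> V) :
  \sum_(t | P t) F t =
  \sum_(x : T) \sum_(t : d.-tuple T | P [tuple of x :: t])
    F [tuple of x :: t].
Proof.
rewrite pair_big_dep /=.
rewrite (reindex (fun p : T * d.-tuple T => [tuple of p.1 :: p.2])) //=.
exists (fun t => (thead t, [tuple of behead t])) => [[x t] _|t _] /=.
  by congr pair; apply: val_inj.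
by apply: val_inj; case/tupleP: t => x t; rewrite /= theadE.
Qed.

Section NestedSums.
Variable R : realType.
Implicit Types l : seq (nat * rat).

Definition polylog_term (k : nat) (q : rat) (n : nat) : R :=
  ratr q ^+ n / n%:R ^+ k.

(** A truncated multiple polylogarithm whose head letter carries the smallest index; the free lower
    bound [m] is what lets the recursion go through. *)
Fixpoint nested_sum l (m N : nat) : R :=
  if l is (k, q) :: l'
  then \sum_(n < N | (m < n)%N) polylog_term k q n * nested_sum l' n N
  else 1.

Lemma polylog_partial_nested_sum (d : nat) (k : d.-tuple nat)
    (q : d.-tuple rat) (N : nat) :
  polylog_partial k [tuple of [seq ratr a | a <- q]] N =
  nested_sum (zip k q) 0 N.
Proof.
rewrite /polylog_partial; move: {1 2}0%N => m.
elim: d k q m => [|d IH] k q m.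
  rewrite (tuple0 k) (tuple0 q) /= (big_pred1 [tuple]) ?big_ord0 // => n.
  by rewrite (tuple0 n).
case/tupleP: k => k0 k; case/tupleP: q => q0 q /=.
rewrite sum_tuple_cons [RHS]big_mkcond /=; apply: eq_bigr => n _.
case: ifP => mn; last first.
  by rewrite big_pred0 // => t; rewrite mn.
rewrite -IH mulr_sumr; apply: eq_big => t //; rewrite ?mn // => _.
rewrite big_ord_recl !tnth_map !tnth0 /=; congr (_ * _).
by apply: eq_bigr => i _; rewrite !tnth_map !tnthS.
Qed.

(** Peeling off the largest index instead of the smallest exposes the coefficients of a power series
    in the last argument. The induction exchanges the sums over the smallest and the largest
    index. *)
Lemma nested_sum_rcons l (k : nat) (q : rat) (m N : nat) :
  nested_sum (rcons l (k, q)) m N =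
  \sum_(n < N | (m < n)%N) polylog_term k q n * nested_sum l m n.
Proof.
elim: l m => [|[k' q'] l IH] m //=.
under eq_bigr do rewrite IH mulr_sumr.
rewrite (exchange_big_dep (fun n : 'I_N => m < n)%N) /=; last first.
  by move=> p n; exact: ltn_trans.
apply: eq_bigr => n mn.
rewrite (big_ord_widen_cond N (ltn m)
  (fun p => polylog_term k' q' p * nested_sum l p n)) ?(ltnW (ltn_ord n)) //.
by rewrite mulr_sumr; apply: eq_bigr => p _; rewrite mulrCA.
Qed.

Lemma polylog_term_ge0 (k : nat) (q : rat) (n : nat) :
  0 <= q -> 0 <= polylog_term k q n.
Proof. by move=> q0; rewrite divr_ge0 ?exprn_ge0 ?ler0q ?ler0n. Qed.

Lemma polylog_termM (k : nat) (q w : rat) (n : nat) :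
  polylog_term k (q * w) n = polylog_term k q n * ratr w ^+ n.
Proof. by rewrite /polylog_term [ratr _]rmorphM [(_ * _) ^+ n]exprMn mulrAC. Qed.

Lemma nested_sum_ge0 l (m N : nat) :
  all (fun p => 0 <= p.2) l -> 0 <= nested_sum l m N.
Proof.
elim: l m => [|[k q] l IH] m //= /andP[q0 l0].
by apply: sumr_ge0 => n _; rewrite mulr_ge0 ?polylog_term_ge0 ?IH.
Qed.

(** * Values in the algebra and their coefficient sequences *)

Lemma polylog_algebra_word l : l != [::] ->
  all (fun p => 0 < p.1)%N l -> cvgn (nested_sum l 0) ->
  polylog_algebra (limn (nested_sum l 0)).
Proof.
move=> l0 kl cl.
pose k := [tuple of map fst (in_tuple l)].
pose q := [tuple of map snd (in_tuple l)].
have E : polylog_partial k [tuple of [seq ratr a | a <- q]] =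
         nested_sum l 0 :> R^nat.
  by apply/funext => N; rewrite polylog_partial_nested_sum zip_unzip.
apply: sub_gen_smallest; exists (size l), k, q.
rewrite /polylog_converges /polylog E; split=> //.
- by case: (l) l0.
- by move=> i; rewrite tnth_map; apply: (allP kl); exact: mem_tnth.
Qed.

Lemma Q_subalgebra_polylog : Q_subalgebra (@polylog_algebra R).
Proof.
split=> [A [[]] //|a x y Ax Ay A AA|x y Ax Ay A AA].
- by have [[_ h _] _] := AA; apply: h; [exact: Ax|exact: Ay].
- by have [[_ _ h] _] := AA; apply: h; [exact: Ax|exact: Ay].
Qed.

Lemma polylog_algebraD (x y : R) :
  polylog_algebra x -> polylog_algebra y -> polylog_algebra (x + y).
Proof.
have [_ h _] := Q_subalgebra_polylog => Ax Ay.
by rewrite -[x]mul1r -(rmorph1 (@ratr R)); exact: h.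
Qed.

(* Coefficient sequences of sums of multiple polylogarithms, viewed as power
   series in a common scaling of the last argument; a word [rcons l (k, q)] contributes the sequence
   [n |-> q^n / n^k * sum_(0 < n_1 < ... < n_d < n) ...]. *)
Inductive polylog_coef : R^nat -> Prop :=
| PolylogCoefWord l (k : nat) (q : rat) (c : R^nat) of
    all (fun p => 0 < p.1)%N l & all (fun p => 0 <= p.2) l &
    (0 < k)%N & 0 <= q &
    (forall n, c n = (0 < n)%N%:R * (polylog_term k q n * nested_sum l 0 n)) :
    polylog_coef c
| PolylogCoefAdd (b c : R^nat) of polylog_coef b & polylog_coef c :
    polylog_coef (b + c).

Lemma polylog_coef_ge0 (c : R^nat) n : polylog_coef c -> 0 <= c n.
Proof.
elim=> [l k q {}c _ l0 _ q0 ->|b {}c _ b0 _ c0]; last exact: addr_ge0.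
by rewrite mulr_ge0 // mulr_ge0 ?polylog_term_ge0 ?nested_sum_ge0.
Qed.

Lemma polylog_coef_lim (c : R^nat) (w : rat) : 0 <= w -> polylog_coef c ->
  cvgn (series (fun n => c n * ratr w ^+ n)) ->
  polylog_algebra (limn (series (fun n => c n * ratr w ^+ n))).
Proof.
move=> w0; elim=> {c} [l k q c kl l0 k0 q0 cE|b c Cb IHb Cc IHc].
  (* Scaling by [w] turns the last argument [q] into [q * w]; the index 0 contributes to neither
     side. *)
  suff -> : series (fun n => c n * ratr w ^+ n) =
            nested_sum (rcons l (k, q * w)) 0.
    apply: polylog_algebra_word; first by rewrite -cats1; case: (l).
    by rewrite all_rcons k0.
  apply/funext => N; rewrite nested_sum_rcons seriesEord big_mkcond /=.
  apply: eq_bigr => n _; rewrite cE; case: ltnP => _; last by rewrite !mul0r.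
  by rewrite mul1r polylog_termM; ring.
have w0' : 0 <= ratr w :> R by rewrite ler0q.
have b0 n : 0 <= b n * ratr w ^+ n.
  by rewrite mulr_ge0 ?exprn_ge0 // polylog_coef_ge0.
have c0 n : 0 <= c n * ratr w ^+ n.
  by rewrite mulr_ge0 ?exprn_ge0 // polylog_coef_ge0.
move=> cbc.
have cb : cvgn (series (fun n => b n * ratr w ^+ n)).
  apply: series_le_cvg cbc => // n; rewrite ?addrfctE mulrDl ?addr_ge0 //.
  by rewrite lerDl.
have cc : cvgn (series (fun n => c n * ratr w ^+ n)).
  apply: series_le_cvg cbc => // n; rewrite ?addrfctE mulrDl ?addr_ge0 //.
  by rewrite lerDr.
have -> : (fun n => (b + c) n * ratr w ^+ n) =
    (fun n => b n * ratr w ^+ n) + (fun n => c n * ratr w ^+ n).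
  by apply/funext => n; rewrite !fctE mulrDl.
by rewrite lim_seriesD //; apply: polylog_algebraD; [exact: IHb|exact: IHc].
Qed.

(* The factor that [x |-> 1/x] contributes after the change of variable
   [w = 1/(x + K)]. *)
Definition geom_conv (K : nat) (c : R^nat) : R^nat :=
  fun n => \sum_(m < n.+1) c m * K%:R ^+ (n - m).

(** Coefficients of [G_K] in powers of [w = 1/(s + K)]; [G_0(s) = 1/s] is the monomial [w]. Division
    by 0 yields 0 at [n = 0], so no constant term arises. *)
Fixpoint mzv_coef (K : nat) : R^nat :=
  if K is K'.+1 then fun n => geom_conv K' (mzv_coef K') n / n%:R
  else fun n => (n == 1)%:R.

Lemma polylog_coef_geom_conv (K : nat) (c : R^nat) : (0 < K)%N ->
  polylog_coef c -> polylog_coef (fun n => geom_conv K c n / n%:R).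
Proof.
move=> K0; elim=> {c} [l k q c kl l0 k0 q0 cE|b c _ IHb _ IHc]; last first.
  have -> : (fun n => geom_conv K (b + c) n / n%:R) =
      (fun n => geom_conv K b n / n%:R) + (fun n => geom_conv K c n / n%:R).
    apply/funext => n; rewrite /geom_conv !fctE -mulrDl -big_split /=.
    by congr (_ / _); apply: eq_bigr => m _; rewrite mulrDl.
  exact: PolylogCoefAdd.
have -> : (fun n => geom_conv K c n / n%:R) =
    (fun n => c n / n%:R) +
    (fun n => (\sum_(m < n) c m * K%:R ^+ (n - m)) / n%:R).
  apply/funext => n; rewrite !fctE -mulrDl; congr (_ / _).
  by rewrite /geom_conv big_ord_recr /= subnn expr0 mulr1 addrC.
apply: PolylogCoefAdd.
  apply: (@PolylogCoefWord l k.+1 q) => // n.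
  by rewrite cE /polylog_term exprSr invfM; ring.
(* Since [K^(n - m) = K^n * (1/K)^m], the old last argument [q] becomes [q / K] and the new largest
   index gets the argument [K]. *)
apply: (@PolylogCoefWord (rcons l (k, q / K%:R)) 1 K%:R) => //.
- by rewrite all_rcons k0.
- by rewrite all_rcons /= divr_ge0 ?ler0n.
- move=> n; rewrite nested_sum_rcons.
  case: ltnP => [n0|]; last by rewrite leqn0 => /eqP ->; rewrite invr0 mulr0 mul0r.
  rewrite mul1r mulr_sumr mulr_suml [RHS]big_mkcond.
  apply: eq_bigr => m _; rewrite cE; case: ltnP => m0; last by rewrite !mul0r.
  have KE : K%:R != 0 :> R by rewrite pnatr_eq0 -lt0n.
  have nE : n%:R != 0 :> R by rewrite pnatr_eq0 -lt0n.
  rewrite polylog_termM fmorphV /= rmorph_nat.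
  rewrite [polylog_term 1 _ _]/polylog_term rmorph_nat expr1 exprVn.
  rewrite exprB ?unitfE // 1?ltnW //; field.
  by rewrite nE expf_neq0.
Qed.

Lemma mzv_coef0 (K : nat) : mzv_coef K 0 = 0.
Proof. by case: K => [|K] /=; rewrite ?invr0 ?mulr0. Qed.

(** A convolution of ratio 0 keeps only the diagonal term, as [0^0 = 1]: [G_1(s) = 1/(s + 1)] is
    again the monomial [w]. *)
Lemma mzv_coef1 n : mzv_coef 1 n = (n == 1)%:R.
Proof.
rewrite /= /geom_conv; case: n => [|n]; first by rewrite invr0 mulr0.
rewrite big_ord_recr big1 /= ?subnn => [|m _]; last first.
  by rewrite subSn ?exprS ?mul0r ?mulr0 // -ltnS.
by case: n => [|n]; rewrite add0r ?mul0r // mul1r expr0 invr1 mulr1.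
Qed.

(** Levels 0 and 1 are the single monomial [w], so the induction starts at level 2, where the ratio
    1 and the division by [n] give [1/n], the coefficients of [Li_1]. *)
Lemma polylog_coef_mzv_coef (K : nat) : polylog_coef (mzv_coef K.+2).
Proof.
elim: K => [|K IH]; last exact: polylog_coef_geom_conv.
apply: (@PolylogCoefWord [::] 1 1) => // n.
rewrite /polylog_term rmorph1 expr1n.
rewrite -[LHS]/(geom_conv 1 (mzv_coef 1) n / n%:R) /geom_conv.
under eq_bigr do rewrite mzv_coef1 expr1n mulr1.
case: n => [|n]; first by rewrite invr0 mulr0 mul0r.
rewrite -(big_mkord predT (fun i => (i == 1)%:R)) big_ltn // add0r.
rewrite big_ltn // big_nat_cond big1 => [|[|[]] //].
by rewrite addr0 eqxx !mul1r mulr1 expr1.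
Qed.

End NestedSums.

(** * Convergence and limits of the power series *)

Section PowerSeries.
Variable R : realType.
Implicit Types (c : R^nat) (w : R) (K : nat).

Definition power_series c w : R^nat := series (fun n => c n * w ^+ n).

Lemma geom_conv_ge0 K c n : (forall m, 0 <= c m) -> 0 <= geom_conv K c n.
Proof.
by move=> c0; apply: sumr_ge0 => m _; rewrite mulr_ge0 ?exprn_ge0 ?ler0n.
Qed.

Lemma geom_convS K c n :
  geom_conv K c n.+1 = K%:R * geom_conv K c n + c n.+1.
Proof.
rewrite /geom_conv big_ord_recr /= subnn expr0 mulr1; congr (_ + _).
rewrite mulr_sumr; apply: eq_bigr => m _.
by rewrite subSn -1?ltnS // exprS mulrCA.
Qed.

Lemma power_series_ndecr c w : (forall n, 0 <= c n) -> 0 <= w ->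
  nondecreasing_seq (power_series c w).
Proof.
move=> c0 w0; apply: (@nondecreasing_series _ _ predT 0) => n _ _.
by rewrite mulr_ge0 ?exprn_ge0.
Qed.

Lemma power_seriesS c w N :
  power_series c w N.+1 = power_series c w N + c N * w ^+ N.
Proof. by rewrite /power_series seriesSr. Qed.

(** Truncated form of [(1 - K w) G = C], where [C] and [G] are the generating series of [c] and
    [geom_conv K c]. *)
Lemma power_series_geom_convS K c w N :
  power_series (geom_conv K c) w N.+1 =
  K%:R * w * power_series (geom_conv K c) w N + power_series c w N.+1.
Proof.
elim: N => [|N IH].
  by rewrite !power_seriesS /power_series !seriesEord /= !big_ord0
    /geom_conv big_ord_recr big_ord0 /= subnn !expr0; ring.
rewrite power_seriesS {1}IH [in RHS]power_seriesS.
by rewrite [power_series c w N.+2]power_seriesS geom_convS exprS; ring.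
Qed.

Lemma cvgn_power_series_geom_conv K c w : (forall n, 0 <= c n) -> 0 <= w ->
  K%:R * w < 1 -> cvgn (power_series c w) ->
  cvgn (power_series (geom_conv K c) w).
Proof.
move=> c0 w0 Kw cc.
have g0 n := geom_conv_ge0 K n c0.
apply: nondecreasing_is_cvgn; first exact: power_series_ndecr.
(* With partial sums [G_N] and [C_N], monotonicity and the truncated identity give [G_N <= G_(N+1) =
   K w G_N + C_(N+1) <= K w G_N + lim C]. *)
exists (limn (power_series c w) / (1 - K%:R * w)) => _ [N _ <-].
have Kw' : 0 < 1 - K%:R * w by rewrite subr_gt0.
rewrite ler_pdivlMr //.
have := nondecreasing_cvgn_le (power_series_ndecr c0 w0) cc N.+1.
have := power_series_geom_convS K c w N.
have := power_series_ndecr g0 w0 (leqnSn N).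
by nra.
Qed.

Lemma limn_power_series_geom_conv K c w : (forall n, 0 <= c n) -> 0 <= w ->
  K%:R * w < 1 -> cvgn (power_series c w) ->
  limn (power_series (geom_conv K c) w) =
  limn (power_series c w) / (1 - K%:R * w).
Proof.
move=> c0 w0 Kw cc; have cg := cvgn_power_series_geom_conv c0 w0 Kw cc.
have Kw' : 1 - K%:R * w != 0 by rewrite gt_eqF // subr_gt0.
apply: (mulIf Kw'); rewrite divfK //.
set G := power_series _ _ in cg *.
suff : limn G = K%:R * w * limn G + limn (power_series c w) by lra.
have h1 : (fun N => G N.+1) @ \oo --> limn G by rewrite (cvg_shiftS G).
have h2 : (fun N => G N.+1) @ \oo -->
    K%:R * w * limn G + limn (power_series c w).
  rewrite (_ : (fun N => G N.+1) =
      (fun N => K%:R * w * G N + power_series c w N.+1)); last first.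
    by apply/funext => N; exact: power_series_geom_convS.
  apply: cvgD; first exact: cvgMl_tmp.
  by rewrite (cvg_shiftS (power_series c w)).
exact: cvg_unique h1 h2.
Qed.

Lemma mzv_coef_ge0 K n : 0 <= mzv_coef R K n.
Proof.
elim: K n => [|K IH] n //=.
by rewrite divr_ge0 ?ler0n ?geom_conv_ge0.
Qed.

Lemma cvgn_mzv_coef0 w : power_series (mzv_coef R 0) w @ \oo --> w.
Proof.
have E N : power_series (mzv_coef R 0) w N.+2 = w.
  elim: N => [|N IH]; rewrite power_seriesS ?IH /= ?mul0r ?addr0 //.
  by rewrite power_seriesS /power_series seriesEord /= big_ord0; ring.
rewrite -(cvg_shiftn 2) (_ : (fun n => _) = cst w); first exact: cvg_cst.
by apply/funext => N; rewrite addn2 E.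
Qed.

(** Level [K] arises from convolutions of ratios [0, ..., K - 1], the largest of which decides
    convergence; the divisions by [n] only shrink the terms. *)
Lemma cvgn_mzv_coef K w : 0 <= w -> K.-1%:R * w < 1 ->
  cvgn (power_series (mzv_coef R K) w).
Proof.
move=> w0; elim: K => [|K IH] Kw.
  by apply/cvg_ex; exists w; exact: cvgn_mzv_coef0.
have {}IH : cvgn (power_series (mzv_coef R K) w).
  apply: IH; apply: le_lt_trans Kw; rewrite ler_wpM2r // ler_nat.
  exact: leq_pred.
have cg := cvgn_power_series_geom_conv (@mzv_coef_ge0 K) w0 Kw IH.
have g0 n := geom_conv_ge0 K n (@mzv_coef_ge0 K).
apply: (series_le_cvg _ _ _ cg) => n; rewrite ?mulr_ge0 ?exprn_ge0 ?mzv_coef_ge0 //.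
rewrite ler_wpM2r ?exprn_ge0 //=; case: n => [|n]; first by rewrite invr0 mulr0.
by rewrite ler_pdivrMr // ler_peMr // ler1n.
Qed.

Lemma nneseries_EFin (u : R^nat) : cvgn (series u) ->
  (\sum_(0 <= n <oo) (u n)%:E)%E = (limn (series u))%:E.
Proof.
move=> cu; rewrite -EFin_lim // (_ : EFin \o series u =
  (fun N => \sum_(0 <= n < N) (u n)%:E)%E) //.
by apply/funext => N /=; rewrite sumEFin.
Qed.

End PowerSeries.

(** * Integrals of negative powers over a half-line *)

Section PowerIntegral.
Variable R : realType.
Implicit Types (a x : R) (n : nat).

Lemma is_derive_shiftVX a n x : a + x != 0 ->
  is_derive x 1 (fun y => (a + y)^-1 ^+ n.+1)
    (- n.+1%:R * (a + x)^-1 ^+ n.+2).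
Proof.
move=> ax.
have d1 : is_derive x 1 (fun y : R => a + y) 1.
  by rewrite -[X in is_derive _ _ _ X]add0r; exact: is_deriveD.
have d2 := @is_deriveV R _ x 1 1 ax d1.
have d3 := @is_deriveX _ _ _ n.+1 _ _ _ d2.
have -> : (fun y => (a + y)^-1 ^+ n.+1) = (fun y => (a + y)^-1) ^+ n.+1.
  by apply/funext => y; rewrite exprfctE.
apply: (is_derive_eq d3).
by rewrite /GRing.scale /= !exprS expr0; field.
Qed.

Lemma continuous_shiftVX a n x : a + x != 0 ->
  {for x, continuous (fun y => (a + y)^-1 ^+ n)}.
Proof.
case: n => [|n] ax; first exact: cst_continuous.
have d := is_derive_shiftVX n ax.
apply: differentiable_continuous; apply/derivable1_diffP.
exact: ex_derive.
Qed.

Lemma within_continuous_shiftVX a n : 0 <= a ->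
  {within `[1, +oo[, continuous (fun y => (a + y)^-1 ^+ n)}.
Proof.
move=> a0; apply: continuous_in_subspaceT => x.
rewrite inE /= in_itv /= andbT => x1.
by apply: continuous_shiftVX; rewrite gt_eqF //; lra.
Qed.

Lemma cvgy_shiftVX a n : (a + x)^-1 ^+ n.+1 @[x --> +oo] --> 0.
Proof.
have h : (a + x)^-1 @[x --> +oo] --> 0.
  apply/(gtr0_cvgV0 (f := fun x => a + x)); last exact: cvg_addrl.
  near=> x; rewrite addrC -ltrBlDr sub0r.
  by near: x; apply: nbhs_pinfty_gt; rewrite num_real.
elim: n => [|n IH]; first exact: h.
rewrite -[X in _ --> X](mulr0 0).
under eq_fun do rewrite exprS.
exact: cvgM.
Unshelve. all: by end_near.
Qed.

Lemma integral_shiftVX a n : 0 <= a ->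
  (\int[@lebesgue_measure R]_(x in `[1%R, +oo[) ((a + x)^-1 ^+ n.+2)%:E =
   ((a + 1)^-1 ^+ n.+1 / n.+1%:R)%:E)%E.
Proof.
move=> a0; have ax x : 1 <= x -> a + x != 0 by move=> x1; rewrite gt_eqF //; lra.
have d x : 1 <= x -> is_derive x 1
    (fun x => - n.+1%:R^-1 * (a + x)^-1 ^+ n.+1) ((a + x)^-1 ^+ n.+2).
  move=> x1; have dx := is_derive_shiftVX n (ax x x1).
  apply: (is_derive_eq (is_deriveZ (- n.+1%:R^-1) dx)).
  by rewrite /GRing.scale /= mulrA mulrNN mulVf ?mul1r.
rewrite (@ge0_continuous_FTC2y _ _
  (fun x => - n.+1%:R^-1 * (a + x)^-1 ^+ n.+1) _ 0).
- by rewrite sub0e -EFinN; congr EFin; ring.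
- by move=> x x1; rewrite exprn_ge0 // invr_ge0; lra.
- exact: within_continuous_shiftVX.
- rewrite -[X in _ --> X](mulr0 (- n.+1%:R^-1)).
  by apply: cvgMl_tmp; exact: cvgy_shiftVX.
- move=> x /ltW x1; have dx := d _ x1.
  exact: ex_derive.
- apply: cvg_at_right_filter; apply: cvgMl_tmp.
  exact: continuous_shiftVX (ax _ _).
- move=> x; rewrite in_itv /= andbT => /ltW x1; have dx := d _ x1.
  by rewrite derive1E derive_val.
Qed.

End PowerIntegral.

(** * Termwise integration and the iterated integral *)

Section MzvIntegral.
Variable R : realType.
Implicit Types (a s x w : R) (c : R^nat) (K n r : nat).

(** With [w = 1/(s + K)] one has [1/s = w / (1 - K w)], so dividing by [s] convolves with a
    geometric series and raises each exponent by one; [s > 0] gives [K w < 1]. *)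
Lemma limn_power_series_shift K s c : (forall n, 0 <= c n) ->
  (forall w, 0 <= w -> K%:R * w < 1 -> cvgn (power_series c w)) -> 0 < s ->
  limn (power_series c (s + K%:R)^-1) / s =
  limn (series (fun n => geom_conv K c n * (s + K%:R)^-1 ^+ n.+1)) /\
  cvgn (series (fun n => geom_conv K c n * (s + K%:R)^-1 ^+ n.+1)).
Proof.
move=> c0 cc s0; set w := (_ + _)^-1.
have sK : 0 < s + K%:R by rewrite ltr_wpDr.
have w0 : 0 <= w by rewrite invr_ge0 ltW.
have Kw : K%:R * w < 1 by rewrite ltr_pdivrMr // mul1r ltrDr.
have {}cc := cc w w0 Kw.
have cg := cvgn_power_series_geom_conv c0 w0 Kw cc.
have -> : (fun n => geom_conv K c n * w ^+ n.+1) =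
    w *: (fun n => geom_conv K c n * w ^+ n).
  by apply/funext => n; rewrite fctE /GRing.scale /= exprS mulrCA.
split; last exact: is_cvg_seriesZ.
rewrite lim_seriesZ // -/(power_series _ _) limn_power_series_geom_conv //.
rewrite /GRing.scale /=; set L := limn _; rewrite /w; field.
by rewrite addrK !gt_eqF.
Qed.

Lemma measurable_shiftVX a n : 0 <= a ->
  measurable_fun (`[1, +oo[ : set R) (fun x => (a + x)^-1 ^+ n).
Proof.
move=> a0; apply: subspace_continuous_measurable_fun => //.
exact: within_continuous_shiftVX.
Qed.

(** The passage from [G_K] to [G_(K+1)]: all terms are nonnegative, so sum and integral may be
    exchanged. *)
Lemma integral_power_series a s K c : 0 <= a -> 0 <= s ->
  (forall n, 0 <= c n) -> c 0 = 0 ->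
  (forall w, 0 <= w -> K%:R * w < 1 -> cvgn (power_series c w)) ->
  cvgn (power_series (fun n => geom_conv K c n / n%:R) (s + K.+1%:R)^-1) ->
  (\int[@lebesgue_measure R]_(x in `[1%R, +oo[)
    (a / (s + x) * limn (power_series c (s + x + K%:R)^-1))%:E =
  (a * limn (power_series (fun n => geom_conv K c n / n%:R)
    (s + K.+1%:R)^-1))%:E)%E.
Proof.
move=> a0 s0 c0 c00 cc cd.
have g0 n : 0 <= geom_conv K c n by exact: geom_conv_ge0.
have sK : 0 <= s + K%:R by rewrite addr_ge0.
pose f n x : \bar R := ((a * geom_conv K c n) * (s + K%:R + x)^-1 ^+ n.+1)%:E.
have fE x : x \in `[1, +oo[ ->
    (a / (s + x) * limn (power_series c (s + x + K%:R)^-1))%:E =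
    (\sum_(0 <= n <oo) f n x)%E.
  rewrite in_itv /= andbT => x1.
  have [E cE] := @limn_power_series_shift K (s + x) c c0 cc ltac:(lra).
  rewrite mulrAC -mulrA E -[X in X%:E = _](lim_seriesZ a cE).
  rewrite -nneseries_EFin; last exact: is_cvg_seriesZ.
  apply: eq_eseriesr => n _.
  by rewrite fctE /f /GRing.scale /= mulrA (addrAC s).
transitivity (\int[@lebesgue_measure R]_(x in `[1%R, +oo[)
    \sum_(0 <= n <oo) f n x)%E.
  by apply: eq_integral => x; rewrite inE => /fE.
have mf n : measurable_fun (`[1, +oo[ : set R) (f n).
  apply/measurable_EFinP; apply: measurable_funM => //.
  exact: measurable_shiftVX.
rewrite integral_nneseries //; last first.
  move=> n x /=; rewrite in_itv /= andbT => x1.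
  by rewrite lee_fin !mulr_ge0 // exprn_ge0 // invr_ge0; lra.
pose d n := geom_conv K c n / n%:R * (s + K.+1%:R)^-1 ^+ n.
have If n : (\int[@lebesgue_measure R]_(x in `[1%R, +oo[) f n x = (a * d n)%:E)%E.
  under eq_integral do rewrite /f EFinM.
  rewrite ge0_integralZl_EFin //; last 3 first.
  - move=> x /=; rewrite in_itv /= andbT => x1.
    by rewrite lee_fin exprn_ge0 // invr_ge0; lra.
  - by apply/measurable_EFinP; exact: measurable_shiftVX.
  - by rewrite mulr_ge0.
  (* The term [n = 0] contains the divergent integral of [1/(s + K + x)]; its coefficient vanishes
     because [c 0 = 0], and 0 times infinity is 0. *)
  case: n => [|n]; last first.
    rewrite integral_shiftVX // -EFinM /d -[K.+1%:R]natr1 (addrA s).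
    by congr EFin; ring.
  rewrite /d /geom_conv big_ord_recr big_ord0 /= c00.
  by rewrite !(mul0r, mulr0, add0r, mul0e).
under eq_eseriesr do rewrite If.
have cad : cvgn (series (a *: d)) by exact: is_cvg_seriesZ.
by rewrite (nneseries_EFin cad) lim_seriesZ.
Qed.

Lemma integral_ge1S (m : nat) (f : m.+1.-tuple R -> \bar R) :
  integral_ge1 f = (\int[@lebesgue_measure R]_(x in `[1%R, +oo[)
    integral_ge1 (fun y : m.-tuple R => f [tuple of x :: y]))%E.
Proof. by []. Qed.

(** The parameters make the induction work: fixing the outermost variable [x] replaces [a] by
    [a / (s + x)] and [s] by [s + x], and the inner integral keeps its shape. *)
Lemma integral_ge1_mzv r a s : 0 <= a -> 0 <= s ->
  integral_ge1 (fun x : r.+1.-tuple R =>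
    (a * (\prod_(i < r.+1) (s + \sum_(j < r.+1 | (j <= i)%N) tnth x j) ^+
       tnth [tuple of rcons (nseq r 1%N) 2%N] i)^-1)%:E) =
  (a * limn (power_series (mzv_coef R r.+1) (s + r.+1%:R)^-1))%:E.
Proof.
elim: r a s => [|r IH] a s a0 s0.
  rewrite /integral_ge1.
  (* The last exponent 2 supplies two factors [1/(s + x)]: one is the kernel of the integration
     step, the other is [G_0(s + x)]. *)
  rewrite -(@integral_power_series a s 0 (mzv_coef R 0)) //.
  - apply: eq_integral => x; rewrite inE /= in_itv /= andbT => x1.
    rewrite addr0 (cvg_lim _ (@cvgn_mzv_coef0 _ _)) // big_ord_recl big_ord0 mulr1.
    rewrite (bigD1 ord0) //= big1 ?addr0; last first.
      by move=> i; rewrite ord1.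
    by rewrite tnth0 (tnth_nth 0%N) /= expr2 invfM mulrA.
  - by move=> w w0 Kw; apply: cvgn_mzv_coef => //=; rewrite mul0r.
  - have := @cvgn_mzv_coef R 1 (s + 1)^-1; apply; rewrite ?mul0r //.
    by rewrite invr_ge0 addr_ge0.
rewrite -(@integral_power_series a s r.+1 (mzv_coef R r.+1)) //.
- rewrite integral_ge1S; apply: eq_integral => x xI.
  have x1 : 1 <= x by move: xI; rewrite inE /= in_itv /= andbT.
  rewrite -IH; [|by rewrite divr_ge0 //; lra|lra].
  congr (integral_ge1 _); apply/funext => y; congr EFin.
  rewrite big_ord_recl /= -mulrA -invfM; congr (_ * (_ * _)^-1).
    rewrite (bigD1 ord0) //= big1 ?addr0 => [|i]; last by case: i => -[].
    by rewrite tnth0 (tnth_nth 0%N) expr1.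
  apply: eq_bigr => i _; congr (_ ^+ _); last by rewrite !(tnth_nth 0%N).
  rewrite big_mkcond big_ord_recl /= tnth0 addrA; congr (_ + _).
  rewrite [RHS]big_mkcond; apply: eq_bigr => j _.
  by rewrite tnthS.
- by move=> n; exact: mzv_coef_ge0.
- exact: mzv_coef0.
- move=> w w0 Kw; apply: cvgn_mzv_coef => //; apply: le_lt_trans Kw.
  by rewrite ler_wpM2r // ler_nat.
- apply: (@cvgn_mzv_coef R r.+2); first by rewrite invr_ge0 addr_ge0.
  have sr : 0 < s + r.+2%:R by rewrite ltr_wpDl.
  by rewrite /= ltr_pdivrMr // mul1r ltr_wpDl // ltr_nat.
Qed.

End MzvIntegral.

Theorem theorem4p2 (R : realType) (r : nat) (hr : (1 <= r)%N) :
  exists2 v : R, @polylog_algebra R v &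
    @continuous_mzv R _ [tuple of rcons (nseq r 1%N) 2%N] = (v%:E)%E.
Proof.
(* The value is [G_(r+1)(0)], so [1/(s + r + 1)] is taken at [s = 0]. *)
pose w : rat := r.+1%:R^-1.
have wE : ratr w = (0 + r.+1%:R)^-1 :> R by rewrite add0r fmorphV /= rmorph_nat.
exists (limn (power_series (mzv_coef R r.+1) (ratr w))).
  (* As [r >= 1], the level [r.+1] is at least 2, where the coefficients are a sum of words. *)
  case: r hr @w wE => [|r] // _ w wE.
  apply: polylog_coef_lim; first by rewrite invr_ge0.
    exact: polylog_coef_mzv_coef.
  rewrite wE; apply: cvgn_mzv_coef; first by rewrite invr_ge0 add0r.
  by rewrite add0r ltr_pdivrMr // mul1r ltr_nat.
rewrite wE -[limn _]mul1r -integral_ge1_mzv // /continuous_mzv.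
congr (integral_ge1 _); apply/funext => x; rewrite mul1r; congr (_^-1%:E).
by apply: eq_bigr => i _; rewrite add0r.
Qed.
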